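(* Every well-filtered core compact $T_0$ space is sober.
   Context: A subset of a space is saturated if it is an intersection of open sets. A family of sets is filtered if it is nonempty and any two members contain a third member of the family. A $T_0$ space $X$ is well-filtered if for every open $U$ and every filtered family $\mathcal K$ of nonempty compact saturated subsets of $X$, $\bigcap\mathcal K\subseteq U$ implies $K\subseteq U$ for some $K\in\mathcal K$. A space $X$ is core compact if its lattice of open sets $\mathcal O(X)$ (ordered by inclusion) is a continuous lattice. A nonempty set $A\subseteq X$ is irreducible if for all closed $F_1,F_2$, $A\subseteq F_1\cup F_2$ implies $A\subseteq F_1$ or $A\subseteq F_2$. $X$ is sober if for every irreducible closed set $F$ there is a unique point $a\in X$ with $F=\overline{\{a\}}$. *)

(* Defs.v *)
From HB Require Import structures.
From mathcomp Require Import all_boot all_order.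
From mathcomp Require Import boolp classical_sets.
From mathcomp Require Import topology.

Set Implicit Arguments.
Unset Strict Implicit.
Unset Printing Implicit Defensive.

Import Order.TTheory.

Local Open Scope classical_set_scope.

Section ContinuousLattice.
Context {d : Order.disp_t} {L : porderType d}.

Definition directed (D : set L) : Prop :=
  D !=set0 /\
  forall x y, D x -> D y -> exists2 z, D z & (x <= z)%O /\ (y <= z)%O.

Definition way_below (x y : L) : Prop :=
  forall (D : set L) (s : L), directed D -> supremums D s -> (y <= s)%O ->
  exists2 z, D z & (x <= z)%O.

End ContinuousLattice.

Definition complete_lattice d (L : porderType d) : Prop :=
  forall A : set L, exists s, supremums A s.

(* In a complete lattice [set y | way_below y x] contains the bottom and is
   closed under binary joins, so its directedness need not be required. *)
Definition continuous_lattice d (L : porderType d) : Prop :=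
  complete_lattice L /\ forall x : L, supremums [set y | way_below y x] x.

Record opens (X : topologicalType) :=
  Opens { opens_set :> set X; opens_open : opens_set \in open }.

HB.instance Definition _ (X : topologicalType) := [isSub for @opens_set X].
HB.instance Definition _ (X : topologicalType) := [Choice of opens X by <:].
HB.instance Definition _ (X : topologicalType) :=
  [SubChoice_isSubPOrder of opens X by <: with set_display].

Lemma opens_leE (X : topologicalType) (U V : opens X) :
  (U <= V)%O = (U `<=` V) :> Prop.
Proof. by rewrite -Order.le_val subsetEset. Qed.

Section Spaces.
Variable X : topologicalType.

Definition core_compact : Prop := continuous_lattice (opens X).

Definition saturated (A : set X) : Prop :=
  exists2 O : set (set X), O `<=` open & A = \bigcap_(U in O) U.

Definition filtered (K : set (set X)) : Prop :=
  K !=set0 /\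
  forall A B, K A -> K B -> exists2 C, K C & C `<=` A /\ C `<=` B.

Definition well_filtered : Prop :=
  forall (U : set X) (K : set (set X)),
    open U -> filtered K ->
    (forall A, K A -> [/\ A !=set0, compact A & saturated A]) ->
    \bigcap_(A in K) A `<=` U -> exists2 A, K A & A `<=` U.

Definition irreducible (A : set X) : Prop :=
  A !=set0 /\
  forall F G : set X, closed F -> closed G ->
    A `<=` F `|` G -> A `<=` F \/ A `<=` G.

Definition sober : Prop :=
  forall F : set X, closed F -> irreducible F ->
    exists! a : X, F = closure [set a].

End Spaces.

Arguments core_compact : clear implicits.
Arguments well_filtered : clear implicits.
Arguments sober : clear implicits.

(* Main.v *)
Require Import Defs.
From mathcomp Require Import all_boot all_order.
From mathcomp Require Import boolp classical_sets topology.

(** Let [F] be an irreducible closed set of a well-filtered core compact [T0]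
space.  The generic point of [F] is found in the intersection of a filtered
family of compact saturated sets, each of which meets [F].

These compact sets are intersections of descending chains
[V 0 >> V 1 >> V 2 >> ...] of open sets, where [>>] is the converse of the
way-below relation.  An open set that covers such an intersection [Q] already
contains some [V n] ([way_below_chain_sub]).  Granting this, [Q] is compact: if
directed open sets cover [Q], their union contains some [V n], so a single one
of them contains [V n.+1], hence [Q].

The proof of [way_below_chain_sub] uses well-filteredness.  If an open [W]
contains no [V n], Zorn's lemma yields an open [A] containing [W] and maximal
among the open sets that contain no [V n].  Choose [x n] in [V n] outside [A].
By maximality, an open set not included in [A] contains all but finitely many
of the [x n].  So the tails of the sequence [x] are compact, and so are their
saturations, which form a decreasing sequence.  None is included in [A], so by
well-filteredness their intersection has a point outside [A]; but that
intersection lies in every [V n], so [W] does not cover [Q].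

Core compactness provides, below any sequence of open sets meeting [F] and
inside its terms, a chain whose terms still meet [F] ([way_below_chain_below]);
irreducibility of [F] allows intersecting two open sets meeting [F] at each
stage.  Applied to the intersections of the terms of two chains, this shows that
the compact sets are filtered.  The complement of [F] contains none of them, so
by well-filteredness they have a common point [a] in [F].  Applied to a constant
sequence, it shows that every open [U] meeting [F] contains one of them, hence
contains [a]; so [F] is the closure of [a]. *)

Set Implicit Arguments.
Unset Strict Implicit.
Unset Printing Implicit Defensive.

Import Order.TTheory.

Local Open Scope classical_set_scope.

Section OpenSetLattice.
Variable X : topologicalType.
Implicit Types U V W : opens X.

Lemma opensP U : open U.
Proof. by have := opens_open U; rewrite inE. Qed.

Definition mk_opens (A : set X) (oA : open A) : opens X := Opens (mem_set oA).

Lemma opens_sup_bigcup (D : set (opens X)) (oD : open (\bigcup_(W in D) W)) :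
  supremums D (mk_opens oD).
Proof.
split=> [W DW|W ubW]; rewrite opens_leE /=; first exact: bigcup_sup.
by apply: bigcup_sub => V /ubW; rewrite opens_leE.
Qed.

Lemma way_below_cover U V (D : set (opens X)) : way_below U V -> directed D ->
  V `<=` \bigcup_(W in D) W -> exists2 W, D W & U `<=` W.
Proof.
move=> UV dD VD.
have oD : open (\bigcup_(W in D) W) by apply: bigcup_open => W _; exact: opensP.
have [|W DW] := UV D (mk_opens oD) dD (opens_sup_bigcup oD).
  by rewrite opens_leE.
by rewrite opens_leE => UW; exists W.
Qed.

Lemma way_below_sub U V : way_below U V -> U `<=` V.
Proof.
move=> UV; have [||W ->//] := @way_below_cover U V [set V] UV.
  by split; [exists V|move=> _ _ -> ->; exists V].
by move=> x Vx; exists V.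
Qed.

Lemma way_below_subr U V W : way_below U V -> V `<=` W -> way_below U W.
Proof.
move=> UV VW D s dD sD Ws; apply: UV dD sD _; apply: le_trans Ws.
by rewrite opens_leE.
Qed.

Lemma core_compact_way_below V (x : X) : core_compact X ->
  opens_set V x -> exists2 U, way_below U V & opens_set U x.
Proof.
move=> [_ /(_ V)[_ lubV]] Vx.
have oD : open (\bigcup_(U in [set U | way_below U V]) U).
  by apply: bigcup_open => U _; exact: opensP.
have := lubV _ (opens_sup_bigcup oD).1.
by rewrite opens_leE => /(_ x Vx)[U UV Ux]; exists U.
Qed.

End OpenSetLattice.

Section DirectedCompactness.
Variable X : topologicalType.

(** The complements of the members of a filter contain a directed family of open
sets.  It covers [A] when the filter has no cluster point in [A], and then one
of its members containing [A] forces the filter to contain the empty set. *)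
Lemma directed_cover_compact (A : set X) :
  (forall D : set (opens X), directed D -> A `<=` \bigcup_(W in D) W ->
    exists2 W, D W & A `<=` W) ->
  compact A.
Proof.
move=> cA F PF FA; apply: contrapT => nclu.
pose D := [set U : opens X | F (~` U)].
have [||W FW AW] := cA D.
- split.
    exists (mk_opens open0); rewrite /D /= setC0; exact: filterT.
  move=> U V FU FV; exists (mk_opens (openU (opensP U) (opensP V))).
    by rewrite /D /= setCU; exact: filterI.
  by rewrite !opens_leE /=; split; [exact: subsetUl|exact: subsetUr].
- move=> a Aa; apply: contrapT => nDa; apply: nclu; exists a; split=> //.
  move=> B N FB Na; apply/set0P/negP => /eqP BN0.
  apply: nDa; exists (mk_opens (@open_interior _ N)).
    apply: filterS FB => b Bb /interior_subset Nb.
    by have : (B `&` N) b by []; rewrite BN0.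
  exact: nbhs_singleton (nbhs_interior Na).
- have /filter_ex[x []] : F (A `&` ~` W) by exact: filterI.
  by move=> /AW.
Qed.

Definition saturation (A : set X) : set X :=
  \bigcap_(U in [set U | open U /\ A `<=` U]) U.

Lemma sub_saturation (A : set X) : A `<=` saturation A.
Proof. by move=> x Ax U [_]; exact. Qed.

Lemma saturation_sub (A U : set X) : open U -> A `<=` U -> saturation A `<=` U.
Proof. by move=> oU AU x; apply. Qed.

Lemma saturationS (A B : set X) : A `<=` B -> saturation A `<=` saturation B.
Proof. by move=> AB x Ax U [oU BU]; apply: Ax; split=> // y /AB/BU. Qed.

Lemma saturation_saturated (A : set X) : saturated (saturation A).
Proof. by exists [set U | open U /\ A `<=` U] => // U []. Qed.

End DirectedCompactness.

Section WayBelowChain.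
Variable X : topologicalType.
Hypothesis X_wf : well_filtered X.

Definition way_below_chain (V : nat -> opens X) :=
  forall n, way_below (V n.+1) (V n).

Lemma way_below_chain_antitone V m n :
  way_below_chain V -> m <= n -> V n `<=` V m.
Proof.
move=> chV /subnKC <-; elim: (n - m) => [|k IH]; first by rewrite addn0.
by rewrite addnS => x /(way_below_sub (chV _)) /IH.
Qed.

(** Zorn's lemma applies because [V n.+1] is way below [V n]: if the union of a
nonempty inclusion-chain of open sets containing [W] contained [V n], then one
of these sets would contain [V n.+1]. *)
Lemma maximal_open_avoiding_chain V (W : set X) :
  way_below_chain V -> open W -> (forall n, ~ V n `<=` W) ->
  exists A, [/\ open A, W `<=` A, forall n, ~ V n `<=` A &
    forall U, open U -> ~ U `<=` A -> exists n, V n `<=` A `|` U].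
Proof.
move=> chV oW nVW.
pose P (A : set X) := open A /\ forall n, ~ V n `<=` A `|` W.
have P0 : P set0 by split; [exact: open0|move=> n; rewrite set0U].
have [F FP Ftot|A [[oA nVA] maxA]] := @Zorn_bigcup X P.
  split=> [|n VF]; first by apply: bigcup_open => A /FP[].
  (* The empty set makes the family nonempty even when [F] is empty. *)
  pose F0 := F `|` [set set0].
  have F0P : F0 `<=` P by move=> A [/FP|->].
  have F0tot : total_on F0 subset.
    by move=> A B [FA|->] [FB|->];
      [exact: Ftot|right; exact: sub0set|left; exact: sub0set|left].
  pose D := [set U : opens X | exists2 A, F0 A & opens_set U = A `|` W].
  have DF A : F0 A -> exists2 U, D U & opens_set U = A `|` W.
    move=> FA; have oAW := openU (F0P _ FA).1 oW.
    by exists (mk_opens oAW) => //; exists A.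
  have [||U [A /F0P[_ nVA] UA]] := @way_below_cover _ _ _ D (chV n).
  - split; first by have [|U DU _] := DF set0; [right|exists U].
    move=> U1 U2 [A1 F1 U1A] [A2 F2 U2A].
    have [A12|A21] := F0tot _ _ F1 F2.
      by exists U2; [exists A2|rewrite !opens_leE U1A U2A; split=> //; exact: setSU].
    by exists U1; [exists A1|rewrite !opens_leE U1A U2A; split=> //; exact: setSU].
  - move=> x /VF[[A FA Ax]|Wx].
      by have [|U DU UA] := DF A; [left|exists U => //; rewrite UA; left].
    by have [|U DU UA] := DF set0; [right|exists U => //; rewrite UA; right].
  - by rewrite UA => /nVA.
exists (A `|` W); split=> //; first exact: openU.
move=> U oU nUA; apply: contrapT => /forallNP nV.
apply: (maxA (A `|` U)).
  rewrite properEneq; split; last exact: subsetUl.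
  by apply/eqP => AU; apply: nUA; rewrite AU => x Ux; left; right.
by split=> [|n VAU]; [exact: openU|apply: (nV n); rewrite setUAC].
Qed.

(** In a directed cover, a member that contains [x n] is not included in [A], so
it already contains a tail; only finitely many entries remain to be covered. *)
Lemma tail_compact (A : set X) (x : nat -> X) :
  (forall n, ~ A (x n)) ->
  (forall U, open U -> ~ U `<=` A ->
    exists N, forall m, N <= m -> U (x m)) ->
  forall n, compact (saturation [set x m | m in [set m | n <= m]]).
Proof.
move=> nAx cofin n; apply: directed_cover_compact => D [_ dirD] covD.
have xcov m : n <= m -> exists2 U, D U & opens_set U (x m).
  by move=> nm; apply: covD; apply: sub_saturation; exists m.
have [U1 DU1 U1x] := xcov n (leqnn n).
have [|N U1N] := cofin U1 (opensP U1); first by move=> /(_ _ U1x)/nAx.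
have [U DU [U1U UN]] : exists2 U, D U & opens_set U1 `<=` U /\
    forall m, n <= m < N -> opens_set U (x m).
  elim: N {U1N} => [|N [U DU [U1U UN]]].
    by exists U1 => //; split=> // m; rewrite ltn0 andbF.
  have [nN|Nn] := leqP n N; last first.
    exists U => //; split=> // m /andP[nm mN].
    by move: (leq_trans Nn nm); rewrite leqNgt mN.
  have [U2 DU2 U2x] := xcov N nN.
  have [U3 DU3] := dirD _ _ DU DU2.
  rewrite !opens_leE => -[UU3 U2U3]; exists U3 => //; split=> [y /U1U/UU3//|m].
  rewrite ltnS (leq_eqVlt m) andb_orr => /orP[/andP[_ /eqP->]|/UN/UU3//].
  exact: U2U3.
exists U => //; apply: saturation_sub; first exact: opensP.
move=> _ [m /= nm <-]; have [Nm|mN] := leqP N m; first exact/U1U/U1N.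
by apply: UN; rewrite nm.
Qed.

Lemma way_below_chain_sub V (W : set X) : way_below_chain V -> open W ->
  \bigcap_n opens_set (V n) `<=` W -> exists n, V n `<=` W.
Proof.
move=> chV oW QW; apply: contrapT => /forallNP nVW.
have [A [oA WA nVA maxA]] := maximal_open_avoiding_chain chV oW nVW.
have [x Vx] : {x : nat -> X & forall n, opens_set (V n) (x n) /\ ~ A (x n)}.
  apply: (@choice _ _ (fun n y => opens_set (V n) y /\ ~ A y)) => n.
  by have /existsNP[y /not_implyP] := nVA n; exists y.
have nAx n : ~ A (x n) := (Vx n).2.
have cofin U : open U -> ~ U `<=` A -> exists N, forall m, N <= m -> U (x m).
  move=> oU /(maxA _ oU)[N VN]; exists N => m Nm.
  by have [/nAx|] := VN _ (way_below_chain_antitone chV Nm (Vx m).1).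
pose K n := saturation [set x m | m in [set m | n <= m]].
have KS m n : m <= n -> K n `<=` K m.
  move=> mn; apply: saturationS; apply: image_subset => k /=; exact: leq_trans.
have Kx n : K n (x n) by apply: sub_saturation; exists n => /=.
have [||z Kz|_ [n _ <-] KA] := @X_wf A (range K) oA.
- split; first by exists (K 0), 0.
  move=> _ _ [m _ <-] [n _ <-]; exists (K (maxn m n)); first by exists (maxn m n).
  by split; apply: KS; rewrite ?leq_maxl ?leq_maxr.
- move=> _ [n _ <-]; split; first by exists (x n).
    exact: tail_compact.
  exact: saturation_saturated.
- apply/WA/QW => n _; have : K n z by apply: Kz; exists n.
  apply: saturation_sub; first exact: opensP.
  move=> _ [m /= nm <-]; apply: (way_below_chain_antitone chV nm).
  exact: (Vx m).1.
- exact: (nAx n) (KA _ (Kx n)).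
Qed.

Lemma way_below_chain_compact V : way_below_chain V ->
  compact (\bigcap_n opens_set (V n)).
Proof.
move=> chV; apply: directed_cover_compact => D dirD covD.
have [|n VD] := way_below_chain_sub chV _ covD.
  by apply: bigcup_open => U _; exact: opensP.
have [U DU VU] := way_below_cover (chV n) dirD VD.
by exists U => // x Qx; apply: VU; exact: Qx.
Qed.

End WayBelowChain.

Section IrreducibleClosedSet.
Variable X : topologicalType.
Hypothesis X_cc : core_compact X.
Variable F : set X.
Hypothesis F_irr : irreducible F.

Lemma irreducible_meetI (U V : set X) : open U -> open V ->
  F `&` U !=set0 -> F `&` V !=set0 -> F `&` (U `&` V) !=set0.
Proof.
move=> oU oV [u [Fu Uu]] [v [Fv Vv]]; apply: contrapT => FUV0.
have [||x Fx|FU|FV] := F_irr.2 (~` U) (~` V).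
- exact: open_closedC.
- exact: open_closedC.
- by rewrite -setCI => UVx; apply: FUV0; exists x.
- exact: (FU u).
- exact: (FV v).
Qed.

(** The next term is chosen way below the intersection of the current term with
the next set of the given sequence; [F] meets this intersection by
irreducibility. *)
Lemma way_below_chain_below (V : nat -> opens X) :
  (forall n, F `&` V n !=set0) ->
  exists W, [/\ way_below_chain W, forall n, F `&` opens_set (W n) !=set0 &
    forall n, W n `<=` V n].
Proof.
move=> FV.
have [g gP] : {g : opens X -> opens X & forall U : opens X, F `&` U !=set0 ->
    way_below (g U) U /\ F `&` g U !=set0}.
  apply: (@choice _ _ (fun U U' : opens X => F `&` U !=set0 ->
    way_below U' U /\ F `&` U' !=set0)) => U.
  have [[x [Fx Ux]]|FU] := pselect (F `&` U !=set0); last by exists U.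
  have [U' U'U U'x] := core_compact_way_below X_cc Ux.
  by exists U' => _; split=> //; exists x.
pose meet (U U' : opens X) := mk_opens (openI (opensP U) (opensP U')).
pose fix W n := if n is m.+1 then g (meet (W m) (V m.+1)) else V 0.
have FW n : F `&` W n !=set0.
  elim: n => [|n IH] /=; first exact: FV.
  by apply: (gP _ _).2; apply: irreducible_meetI => //; exact: opensP.
have gW n : way_below (W n.+1) (meet (W n) (V n.+1)).
  by apply: (gP _ _).1; apply: irreducible_meetI => //; exact: opensP.
exists W; split=> // [n|[//|n]].
  by apply: way_below_subr (gW n) _; exact: subIsetl.
by move=> x /(way_below_sub (gW n))[].
Qed.

Hypothesis X_wf : well_filtered X.
Hypothesis F_closed : closed F.

Lemma irreducible_closed_generic : exists a, F = closure [set a].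
Proof.
pose meeting (V : nat -> opens X) :=
  way_below_chain V /\ forall n, F `&` V n !=set0.
pose K := [set \bigcap_n opens_set (V n) | V in meeting].
have dense (U : set X) : open U -> F `&` U !=set0 -> exists2 Q, K Q & Q `<=` U.
  move=> oU FU; have [//|W [chW FW WU]] :=
    way_below_chain_below (V := fun=> mk_opens oU).
  exists (\bigcap_n opens_set (W n)); first by exists W.
  by move=> x Qx; apply: (WU 0); exact: Qx.
have filtK : filtered K.
  split.
    have [||Q KQ _] := dense setT; [exact: openT| |by exists Q].
    by rewrite setIT; exact: F_irr.1.
  move=> _ _ [V [chV FV] <-] [V' [chV' FV'] <-].
  have [|W [chW FW WV]] := way_below_chain_below
      (V := fun n => mk_opens (openI (opensP (V n)) (opensP (V' n)))).
    by move=> n; apply: irreducible_meetI => //; exact: opensP.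
  exists (\bigcap_n opens_set (W n)); first by exists W.
  by split=> x Qx n _; have [] := WV n x (Qx n I).
have meetF V : meeting V -> ~ \bigcap_n opens_set (V n) `<=` ~` F.
  move=> [chV FV] /(way_below_chain_sub X_wf chV (closed_openC F_closed))[n VF].
  by have [x [Fx /VF]] := FV n.
have [a Ka Fa] : exists2 a, (\bigcap_(Q in K) Q) a & F a.
  apply: contrapT => nKF.
  have [|x Kx Fx|_ [V mV <-]] :=
      X_wf (closed_openC F_closed) filtK.
  - move=> _ [V mV <-]; split.
    + by have /existsNP[x /not_implyP[Qx _]] := meetF _ mV; exists x.
    + exact: (way_below_chain_compact X_wf mV.1).
    + exists (range (fun n => opens_set (V n))); last by rewrite bigcap_image.
      by move=> _ [n _ <-]; exact: opensP.
  - by apply: nKF; exists x.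
  - exact: meetF.
exists a; apply/seteqP; split.
  move=> x Fx B /nbhs_interior Bx.
  have [||Q KQ QB] := dense B°; first exact: open_interior.
    by exists x; split=> //; exact: nbhs_singleton.
  by exists a; split=> //; apply: interior_subset; apply: QB; exact: Ka.
by rewrite [X in _ `<=` X](closure_id F).1 //; apply: closureS => _ ->.
Qed.

End IrreducibleClosedSet.

Lemma kolmogorov_closure_inj (X : topologicalType) (a b : X) :
  kolmogorov_space X -> closure [set a] = closure [set b] -> a = b.
Proof.
move=> T0 ab; apply: contrapT => /eqP /T0[A].
have sep (c d : X) : closure [set c] = closure [set d] ->
    A \in nbhs c -> d \in ~` A -> False.
  rewrite !inE => cd /[swap] nAd Ac.
  have : closure [set d] c by rewrite -cd; exact: subset_closure.
  by move=> /(_ _ Ac)[_ [-> /nAd]].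
by move=> [[]|[]]; apply: sep.
Qed.

Theorem corollary3p15 (X : topologicalType) (X_T0 : kolmogorov_space X)
  (X_wf : well_filtered X) (X_cc : core_compact X) : sober X.
Proof.
move=> F F_closed F_irr.
have [a Fa] := irreducible_closed_generic X_cc F_irr X_wf F_closed.
exists a; split=> // b Fb.
by apply: kolmogorov_closure_inj; rewrite // -Fa.
Qed.
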